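(* The coefficient $G_2$ satisfies the cloning property: for every $n\ge 1$ and every random vector $\mathbf{X}$ in $\mathbb{R}^n$ with finite second moment, mean $\mathbf{m}\neq0$ and invertible covariance matrix, if $(\mathbf{X},\mathbf{X}')$ denotes the $2n$-dimensional random vector formed by two independent random vectors each having the law of $\mathbf{X}$, then $$G_2\big((\mathbf{X},\mathbf{X}')\big)=G_2(\mathbf{X}).$$
   Context: For a random vector $\mathbf{X}\sim\mu$ in $\mathbb{R}^n$ with finite second moment, mean $\mathbf{m}\neq 0$ and invertible covariance matrix $\Sigma$, $$G_2(\mathbf{X})=G_2(\mu):=\Bigg(\frac{1}{2\mathbf{m}^T\Sigma^{-1}\mathbf{m}}\int_{\mathbb{R}^n}\int_{\mathbb{R}^n}(\mathbf{x}-\mathbf{y})^T\Sigma^{-1}(\mathbf{x}-\mathbf{y})\,\mu(d\mathbf{x})\,\mu(d\mathbf{y})\Bigg)^{1/2}.$$ *)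

(* Defs.v *)
From HB Require Import structures.
From mathcomp Require Import all_boot all_order all_algebra.
From mathcomp Require Import all_classical all_reals all_analysis.

Set Implicit Arguments.
Unset Strict Implicit.
Unset Printing Implicit Defensive.

Import Order.TTheory GRing.Theory Num.Theory.
Import numFieldNormedType.Exports.

Local Open Scope classical_set_scope.
Local Open Scope ring_scope.

(* A vector of R^n is an [n.-tuple R]: tuples carry the product sigma-algebra
   of the Borel sigma-algebra of R, i.e. the Borel sigma-algebra of R^n. They
   are turned into column vectors for linear algebra. *)
Definition colv (R : realType) (n : nat) (x : n.-tuple R) : 'cV[R]_n :=
  \col_i tnth x i.

Section law.
Context {R : realType} {n : nat} (mu : probability (n.-tuple R) R).

Definition finite_second_moment : Prop :=
  (\int[mu]_x (\sum_(i < n) tnth x i ^+ 2)%:E < +oo)%E.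

Definition mean_vec : 'cV[R]_n :=
  \col_i fine 'E_mu[fun x : n.-tuple R => tnth x i].

Definition cov_mx : 'M[R]_n :=
  \matrix_(i, j) fine (covariance mu (fun x : n.-tuple R => tnth x i)
                                     (fun x : n.-tuple R => tnth x j)).

(* The value v^T Sigma^-1 v of the 1 x 1 matrix. *)
Definition inv_cov_form (v : 'cV[R]_n) : R :=
  (v^T *m invmx cov_mx *m v) 0 0.

(* Meaningful only when [finite_second_moment], [mean_vec != 0] and
   [cov_mx \in unitmx]; otherwise [fine], [/] or [invmx] give junk values. *)
Definition G2_law : R :=
  Num.sqrt ((2 * inv_cov_form mean_vec)^-1 *
            \int[mu]_x \int[mu]_y inv_cov_form (colv x - colv y)).

End law.

Section random_vectors.
Context {d : measure_display} {T : measurableType d} {R : realType}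
        {P : probability T R}.

Definition law {n : nat} (X : {RV P >-> n.-tuple R}) :
  probability (n.-tuple R) R := distribution P X.

Definition G2 {n : nat} (X : {RV P >-> n.-tuple R}) : R := G2_law (law X).

Definition independent_RV {n p : nat}
    (X : {RV P >-> n.-tuple R}) (Y : {RV P >-> p.-tuple R}) : Prop :=
  forall (A : set (n.-tuple R)) (B : set (p.-tuple R)),
    measurable A -> measurable B ->
    P (X @^-1` A `&` Y @^-1` B) = (P (X @^-1` A) * P (Y @^-1` B))%E.

Section joint.
Context {n p : nat} (X : {RV P >-> n.-tuple R}) (Y : {RV P >-> p.-tuple R}).

Definition joint_fun (w : T) : (n + p).-tuple R := [tuple of X w ++ Y w].

Lemma measurable_joint_fun : measurable_fun [set: T] joint_fun.
Proof.
apply/measurable_fun_tnthP => i.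
case: (split_ordP i) => j ->.
- rewrite (_ : _ \o _ = @tnth n R ^~ j \o X); last first.
    by apply/funext => w /=; rewrite tnth_lshift.
  by apply: measurableT_comp; [exact: measurable_tnth|exact: measurable_funPT].
- rewrite (_ : _ \o _ = @tnth p R ^~ j \o Y); last first.
    by apply/funext => w /=; rewrite tnth_rshift.
  by apply: measurableT_comp; [exact: measurable_tnth|exact: measurable_funPT].
Qed.

HB.instance Definition _ :=
  isMeasurableFun.Build _ _ _ _ joint_fun measurable_joint_fun.

Definition joint : {RV P >-> (n + p).-tuple R} := joint_fun.

End joint.
End random_vectors.

(* Main.v *)
From HB Require Import structures.
Require Import Defs.
From mathcomp Require Import all_boot all_order all_algebra.
From mathcomp Require Import all_classical all_reals all_analysis.
From mathcomp Require Import measurable_realfun.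

(* The double integral in G_2 does not depend on the law: it is
   2 tr (Sigma^-1 Sigma) = 2 n, so G_2 = sqrt (n / (m^T Sigma^-1 m)). By
   independence the covariance matrix of (X, X') is block diagonal with blocks
   Sigma, Sigma, and its mean is (m, m); hence both n and m^T Sigma^-1 m are
   doubled and the quotient is unchanged. *)

Set Implicit Arguments.
Unset Strict Implicit.
Unset Printing Implicit Defensive.

Import Order.TTheory GRing.Theory Num.Theory.
Import numFieldNormedType.Exports.

Local Open Scope classical_set_scope.
Local Open Scope ring_scope.

(** * Square-integrable functions, expectation and covariance *)

Section second_moments.
Context {d : measure_display} {T : measurableType d} {R : realType}.
Implicit Type P : probability T R.

(** This bridges [finite_second_moment], stated by an integral of squares, and the space
    [Lfun mu 2%:E], whose closure properties the later proofs use. *)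
Lemma Lfun2P (mu : {measure set T -> \bar R}) (f : T -> R) :
  measurable_fun [set: T] f ->
  f \in Lfun mu 2%:E <-> (\int[mu]_x (f x ^+ 2)%:E < +oo)%E.
Proof.
move=> mf; split=> [/Lfun2_integrable_sqr/integrable_lty|f2oo].
  exact.
rewrite inE; apply/andP; split; rewrite inE//= /finite_norm unlock /Lnorm.
rewrite poweR_lty//; under eq_integral => x _ do
  rewrite /= powR_mulrn// -normrX ger0_norm ?sqr_ge0//.
exact: f2oo.
Qed.

Lemma Lfun2_Lfun1 P (f : T -> R) : f \in Lfun P 2%:E -> f \in Lfun P 1.
Proof. by apply: Lfun_subset12; exact: fin_num_measure. Qed.

Lemma RintegralE P (f : T -> R) : \int[P]_x f x = fine ('E_P[f])%E.
Proof. by rewrite unlock. Qed.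

Lemma Rintegral_sum (mu : {measure set T -> \bar R}) (I : Type) (s : seq I)
    (f : I -> T -> R) :
  (forall i, mu.-integrable [set: T] (EFin \o f i)) ->
  \int[mu]_x (\sum_(i <- s) f i x) = \sum_(i <- s) \int[mu]_x f i x.
Proof.
move=> intf; rewrite /Rintegral; under eq_integral do rewrite -sumEFin.
rewrite integral_sum// sum_fine// => i _; exact: integrable_fin_num (intf i).
Qed.

Lemma integrable_Rsum (mu : {measure set T -> \bar R}) (I : Type) (s : seq I)
    (f : I -> T -> R) :
  (forall i, mu.-integrable [set: T] (EFin \o f i)) ->
  mu.-integrable [set: T] (EFin \o (fun x => \sum_(i <- s) f i x)).
Proof.
move=> intf.
rewrite (_ : _ \o _ = fun x => (\sum_(i <- s) (EFin \o f i) x)%E).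
  exact: integrable_sum.
by apply/funext => x /=; rewrite sumEFin.
Qed.

Lemma Lfun2_mul_integrable P (f g : T -> R) :
  f \in Lfun P 2%:E -> g \in Lfun P 2%:E ->
  P.-integrable [set: T] (EFin \o (f \* g)).
Proof. by move=> f2 g2; apply/Lfun1_integrable; exact: Lfun2_mul_Lfun1. Qed.

Lemma covariance_Lfun2E P (f g : T -> R) :
  f \in Lfun P 2%:E -> g \in Lfun P 2%:E ->
  covariance P f g = ('E_P[f * g] - 'E_P[f] * 'E_P[g])%E.
Proof.
move=> f2 g2; rewrite covarianceE//; [exact: Lfun2_Lfun1..|].
exact: Lfun2_mul_Lfun1.
Qed.

Lemma Lfun2_subl P (f : T -> R) a :
  f \in Lfun P 2%:E -> (cst a \- f) \in Lfun P 2%:E.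
Proof. by move=> f2; rewrite rpredB ?lee1n//= => _; exact: Lfun_cst. Qed.

(** This is E[UV] = E[U] E[V] + cov(U, V) for U = a - f and V = b - g. It serves both integrations
    of the double integral: with a, b coordinates of x in the inner one, and coordinates of the mean
    in the outer one. *)
Lemma Rintegral_subl_mul P (f g : T -> R) a b :
  f \in Lfun P 2%:E -> g \in Lfun P 2%:E ->
  \int[P]_y ((a - f y) * (b - g y)) =
  (a - fine ('E_P[f])%E) * (b - fine ('E_P[g])%E) + fine (covariance P f g).
Proof.
move=> f2 g2; have [f1 g1] := (Lfun2_Lfun1 f2, Lfun2_Lfun1 g2).
have fin1 h : h \in Lfun P 1 -> ('E_P[h] \is a fin_num)%E.
  exact: expectation_fin_num.
have Esub (h : T -> R) c : h \in Lfun P 1 ->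
    fine ('E_P[cst c \- h])%E = c - fine ('E_P[h])%E.
  move=> h1; rewrite expectationB ?Lfun_cst// expectation_cst fineB//.
  exact: fin1.
have f2' := Lfun2_subl a f2; have g2' := Lfun2_subl b g2.
rewrite RintegralE.
(* Constants have zero covariance with everything, and the two minus signs cancel. *)
have -> : covariance P f g = covariance P (cst a \- f) (cst b \- g).
  rewrite covarianceBl ?Lfun_cst// !covarianceBr ?Lfun_cst//.
  by rewrite !covariance_cst_l covariance_cst_r !sub0e oppeK oppe0 add0e.
rewrite covariance_Lfun2E//.
rewrite -!Esub// fineB ?fin_numM ?fin1//; last 3 first.
- exact: Lfun2_mul_Lfun1.
- exact: Lfun2_Lfun1.
- exact: Lfun2_Lfun1.
by rewrite fineM ?fin1 ?Lfun2_Lfun1// addrC subrK.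
Qed.

End second_moments.

(** * Change of variables between a random variable and its law *)

Section distribution_moments.
Context {d d' : measure_display} {T : measurableType d} {T' : measurableType d'}
  {R : realType} {P : probability T R} (Z : {RV P >-> T'}).
Implicit Types f g : T' -> R.

(** The square is nonnegative, so the change of variables holds even for an infinite integral; this
    gives both directions at once. *)
Lemma Lfun2_distribution f : measurable_fun [set: T'] f ->
  f \in Lfun (distribution P Z) 2%:E <-> f \o Z \in Lfun P 2%:E.
Proof.
move=> mf; have mfZ : measurable_fun [set: T] (f \o Z).
  by apply: measurableT_comp => //; exact: measurable_funPT.
rewrite Lfun2P// Lfun2P// ge0_integral_distribution// => [|y].
  by apply/measurable_EFinP; exact: measurable_funX.
by rewrite lee_fin sqr_ge0.
Qed.

Lemma expectation_distribution f : measurable_fun [set: T'] f ->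
  f \o Z \in Lfun P 1 -> ('E_(distribution P Z)[f] = 'E_P[f \o Z])%E.
Proof.
move=> mf fZ; rewrite unlock integral_distribution//.
  exact/measurable_EFinP.
exact/Lfun1_integrable.
Qed.

Lemma covariance_distribution f g :
  measurable_fun [set: T'] f -> measurable_fun [set: T'] g ->
  f \o Z \in Lfun P 2%:E -> g \o Z \in Lfun P 2%:E ->
  covariance (distribution P Z) f g = covariance P (f \o Z) (g \o Z).
Proof.
move=> mf mg f2 g2; have [f1 g1] := (Lfun2_Lfun1 f2, Lfun2_Lfun1 g2).
have fg1 : (f * g) \o Z \in Lfun P 1 by exact: Lfun2_mul_Lfun1 f2 g2.
have mfg : measurable_fun [set: T'] (f * g) by exact: measurable_funM.
have f2' : f \in Lfun (distribution P Z) 2%:E by exact/Lfun2_distribution.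
have g2' : g \in Lfun (distribution P Z) 2%:E by exact/Lfun2_distribution.
rewrite !covariance_Lfun2E//.
by rewrite !expectation_distribution.
Qed.

End distribution_moments.

(** * Independence and the product of expectations *)

Section product_rule.
Context {d d1 d2 : measure_display} {T : measurableType d}
  {T1 : measurableType d1} {T2 : measurableType d2} {R : realType}
  {P : probability T R} (X : {RV P >-> T1}) (Y : {RV P >-> T2}).

(** Values are pairs rather than concatenated tuples, so that the law lives on the space of the
    product measure and Fubini applies. *)
Definition pair_fun (w : T) : T1 * T2 := (X w, Y w).

Lemma measurable_pair_fun : measurable_fun [set: T] pair_fun.
Proof. by apply: measurable_fun_pair; exact: measurable_funPT. Qed.

HB.instance Definition _ :=
  isMeasurableFun.Build _ _ _ _ pair_fun measurable_pair_fun.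

Definition pair_RV : {RV P >-> (T1 * T2)%type} := pair_fun.

Hypothesis XY : forall A B, measurable A -> measurable B ->
  P (X @^-1` A `&` Y @^-1` B) = (P (X @^-1` A) * P (Y @^-1` B))%E.

(** The product measure is determined by its values on measurable rectangles, and there the equality
    is [XY]. *)
Lemma distribution_pairE (A : set (T1 * T2)) : measurable A ->
  distribution P pair_RV A = (distribution P X \x distribution P Y)%E A.
Proof.
by move=> mA; apply/esym/product_measure_unique => // B C mB mC; exact: XY.
Qed.

(** The left side is the integral of f(x) g(y) against the law of the pair, which is the product of
    the two laws; Fubini then factors it. *)
Lemma independent_expectationM (f : T1 -> R) (g : T2 -> R) :
  measurable_fun [set: T1] f -> measurable_fun [set: T2] g ->
  f \o X \in Lfun P 2%:E -> g \o Y \in Lfun P 2%:E ->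
  ('E_P[(f \o X) * (g \o Y)] = 'E_P[f \o X] * 'E_P[g \o Y])%E.
Proof.
move=> mf mg f2 g2; have [f1 g1] := (Lfun2_Lfun1 f2, Lfun2_Lfun1 g2).
pose h (z : T1 * T2) := f z.1 * g z.2.
have mh : measurable_fun [set: T1 * T2] h.
  apply: measurable_funM.
  - by apply: measurableT_comp => //; exact: measurable_fst.
  - by apply: measurableT_comp => //; exact: measurable_snd.
have hZ : h \o pair_RV \in Lfun P 1 by exact: Lfun2_mul_Lfun1 f2 g2.
(* Integrability on [P] comes from square integrability of both factors; it passes to the law of the
   pair and from there to the product measure. *)
have inth : (distribution P X \x distribution P Y)%E.-integrable
    [set: T1 * T2] (EFin \o h).
  have : (distribution P pair_RV).-integrable [set: T1 * T2] (EFin \o h).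
    apply: integrable_pushforward => //.
      exact/measurable_EFinP.
    exact/Lfun1_integrable.
  move=> /integrableP[mEh hoo]; apply/integrableP; split => //.
  rewrite (eq_measure_integral (distribution P pair_RV))// => A mA _.
  exact/esym/distribution_pairE.
rewrite -[LHS](@expectation_distribution _ _ _ _ _ _ pair_RV h)// unlock.
rewrite (eq_measure_integral (distribution P X \x distribution P Y)%E); last first.
  by move=> A mA _; exact: distribution_pairE.
rewrite -integral12_prod_meas1//.
have fE : ('E_P[f \o X] = 'E_(distribution P X)[f])%E.
  by rewrite expectation_distribution.
have gE : ('E_P[g \o Y] = 'E_(distribution P Y)[g])%E.
  by rewrite expectation_distribution.
have intf : (distribution P X).-integrable [set: T1] (EFin \o f).
  by apply: integrable_pushforward => //;
    [exact/measurable_EFinP|exact/Lfun1_integrable].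
have intg : (distribution P Y).-integrable [set: T2] (EFin \o g).
  by apply: integrable_pushforward => //;
    [exact/measurable_EFinP|exact/Lfun1_integrable].
have := fE; have := gE; rewrite unlock => -> ->.
rewrite /fubini_F; under eq_integral => x _.
  under eq_integral => y _ do rewrite /h/= EFinM.
  rewrite integralZl//.
  over.
(* The integral of [g] is exhibited as a real constant so that it can leave the outer integral. *)
rewrite /= -(fineK (integrable_fin_num _ intg))//.
by rewrite integralZr.
Qed.

Lemma independent_covariance0 (f : T1 -> R) (g : T2 -> R) :
  measurable_fun [set: T1] f -> measurable_fun [set: T2] g ->
  f \o X \in Lfun P 2%:E -> g \o Y \in Lfun P 2%:E ->
  covariance P (f \o X) (g \o Y) = 0%E.
Proof.
move=> mf mg f2 g2; rewrite covariance_Lfun2E//.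
rewrite independent_expectationM// subee// fin_numM//.
- exact/expectation_fin_num/Lfun2_Lfun1.
- exact/expectation_fin_num/Lfun2_Lfun1.
Qed.

End product_rule.

(** * Closed form of the coefficient for a law on tuples *)

Section tuple_law.
Context {R : realType} {n : nat}.
Implicit Types mu nu : probability (n.-tuple R) R.

Local Notation coord i := (fun x : n.-tuple R => tnth x i).

(** Each squared coordinate is dominated by the sum of squares, and a finite sum of integrable
    squares is integrable. *)
Lemma finite_second_momentP mu :
  finite_second_moment mu <-> forall i, coord i \in Lfun mu 2%:E.
Proof.
have m2 i : measurable_fun [set: n.-tuple R] (fun x => (tnth x i ^+ 2)%:E).
  by apply/measurable_EFinP/measurable_funX; exact: measurable_tnth.
split=> [foo i|f2].
- apply/Lfun2P; first exact: measurable_tnth.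
  apply: le_lt_trans foo; apply: ge0_le_integral => //.
  + by move=> x _; rewrite lee_fin sqr_ge0.
  + under eq_fun do rewrite -sumEFin.
    exact: emeasurable_sum.
  + move=> x _; rewrite lee_fin (bigD1 i)//= lerDl.
    by apply: sumr_ge0 => j _; exact: sqr_ge0.
- apply: integrable_lty => //.
  apply: (integrable_Rsum (mu := mu) _ (f := fun (i : 'I_n) x => tnth x i ^+ 2)) => i.
  exact: Lfun2_integrable_sqr.
Qed.

Lemma inv_cov_formE mu (v : 'cV[R]_n) :
  inv_cov_form mu v =
  \sum_i \sum_j invmx (cov_mx mu) i j * (v i 0 * v j 0).
Proof.
rewrite /inv_cov_form mxE exchange_big/=; apply: eq_bigr => j _.
rewrite mxE big_distrl/=; apply: eq_bigr => i _.
by rewrite !mxE mulrA (mulrC (v i 0)).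
Qed.

Lemma cov_mx_sym mu : (cov_mx mu)^T = cov_mx mu.
Proof. by apply/matrixP => i j; rewrite !mxE covarianceC. Qed.

(** After expansion into terms [A i j] (x_i - y_i)(x_j - y_j), each of the two integrations
    contributes one copy of [C i j], whence the factor 2. *)
Lemma double_integral_inv_cov_form mu :
  finite_second_moment mu -> cov_mx mu \in unitmx ->
  \int[mu]_x \int[mu]_y inv_cov_form mu (colv x - colv y) = 2 * n%:R.
Proof.
move=> /finite_second_momentP f2 muU.
pose A := invmx (cov_mx mu).
pose m i := fine ('E_mu[coord i])%E.
pose C i j := fine (covariance mu (coord i) (coord j)).
have c2 i a : cst a \- coord i \in Lfun mu 2%:E by exact: Lfun2_subl.
have intD i j a b : mu.-integrable [set: n.-tuple R]
    (EFin \o (fun y => A i j * ((a - tnth y i) * (b - tnth y j)))).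
  apply/Lfun1_integrable.
  rewrite [X in X \in _](_ : _ =
    A i j \o* ((cst a \- coord i) \* (cst b \- coord j))); last first.
    by apply/funext => y /=; rewrite mulrC.
  by apply: Lfun_scale => //; exact: Lfun2_mul_Lfun1.
have intc (c : R) : \int[mu]_x c = c.
  by rewrite Rintegral_cst// [X in fine X]probability_setT mulr1.
(* For fixed x, integrating over y replaces y by its mean and adds the covariance. *)
have inner x : \int[mu]_y inv_cov_form mu (colv x - colv y) =
    \sum_i \sum_j A i j * ((tnth x i - m i) * (tnth x j - m j) + C i j).
  under eq_Rintegral => y _ do rewrite inv_cov_formE.
  rewrite (Rintegral_sum (mu := mu) _ (f := fun i y => \sum_j A i j *
    ((colv x - colv y) i 0 * (colv x - colv y) j 0))); last first.
    move=> i; apply: (integrable_Rsum (mu := mu) _ (f := fun j y => A i j *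
      ((colv x - colv y) i 0 * (colv x - colv y) j 0))) => j.
    by under eq_fun do rewrite /= !mxE; exact: intD.
  apply: eq_bigr => i _.
  rewrite (Rintegral_sum (mu := mu) _ (f := fun j y => A i j *
    ((colv x - colv y) i 0 * (colv x - colv y) j 0))); last first.
    by move=> j; under eq_fun do rewrite /= !mxE; exact: intD.
  apply: eq_bigr => j _.
  under eq_Rintegral => y _ do rewrite !mxE.
  rewrite RintegralZl ?Rintegral_subl_mul//.
  exact: Lfun2_mul_integrable (c2 i (tnth x i)) (c2 j (tnth x j)).
have intC i j : mu.-integrable [set: n.-tuple R]
    (EFin \o (fun x => (tnth x i - m i) * (tnth x j - m j))).
  rewrite [X in _.-integrable _ X](_ : _ =
    EFin \o ((cst (m i) \- coord i) \* (cst (m j) \- coord j))).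
    exact: Lfun2_mul_integrable.
  (* Flipping both differences leaves the product unchanged and gives the constant-minus-coordinate
     shape of [c2]. *)
  by apply/funext => x /=; rewrite -mulrNN !opprB.
have intCc i j : mu.-integrable [set: n.-tuple R]
    (EFin \o (fun x => (tnth x i - m i) * (tnth x j - m j) + C i j)).
  apply/Lfun1_integrable; rewrite [X in X \in _](_ : _ =
    (fun x => (tnth x i - m i) * (tnth x j - m j)) \+ cst (C i j))//.
  by rewrite rpredD ?Lfun_cst//=; exact/Lfun1_integrable.
have intAC i j : mu.-integrable [set: n.-tuple R] (EFin \o (fun x =>
    A i j * ((tnth x i - m i) * (tnth x j - m j) + C i j))).
  apply/Lfun1_integrable; rewrite [X in X \in _](_ : _ = A i j \o*
    (fun x => (tnth x i - m i) * (tnth x j - m j) + C i j)); last first.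
    by apply/funext => x /=; rewrite mulrC.
  by apply: Lfun_scale => //; exact/Lfun1_integrable.
under eq_Rintegral => x _ do rewrite inner.
rewrite (Rintegral_sum (mu := mu) _ (f := fun i x => \sum_j
    A i j * ((tnth x i - m i) * (tnth x j - m j) + C i j))); last first.
  by move=> i; exact: (integrable_Rsum (mu := mu) _ (f := fun j x =>
    A i j * ((tnth x i - m i) * (tnth x j - m j) + C i j))).
(* The indices [j i], available because the covariance matrix is symmetric, make the inner sum a
   diagonal entry of the product of [A] and [cov_mx mu]. *)
transitivity (\sum_i \sum_j 2 * (A i j * cov_mx mu j i)).
  apply: eq_bigr => i _.
  rewrite (Rintegral_sum (mu := mu) _ (f := fun j x =>
    A i j * ((tnth x i - m i) * (tnth x j - m j) + C i j)))//.
  apply: eq_bigr => j _.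
  rewrite RintegralZl// RintegralD//; last first.
    exact: finite_measure_integrable_cst.
  under eq_Rintegral => x _ do rewrite -mulrNN !opprB.
  (* Here the constants are the means themselves, so the product of centred means vanishes and only
     the covariance is left. *)
  rewrite Rintegral_subl_mul// !subrr mul0r add0r intc.
  rewrite -/(C i j) -[cov_mx mu]cov_mx_sym 2!mxE -/(C i j).
  by rewrite mulrCA mulr_natl mulr2n.
under eq_bigr => i _ do rewrite -mulr_sumr.
rewrite -mulr_sumr; congr (2 * _).
(* The dimension is read as the trace of the identity, that is, of the inverse covariance matrix
   times the covariance matrix. *)
rewrite -[RHS](mxtrace1 R n) -(mulVmx muU) /mxtrace.
by apply: eq_bigr => i _; rewrite mxE.
Qed.

Lemma G2_lawE mu : finite_second_moment mu -> cov_mx mu \in unitmx ->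
  G2_law mu = Num.sqrt (n%:R / inv_cov_form mu (mean_vec mu)).
Proof.
move=> mu2 muU; rewrite /G2_law double_integral_inv_cov_form//.
by rewrite invfM mulrACA mulVf ?mul1r ?pnatr_eq0// mulrC.
Qed.

(** The laws of the two copies agree with that of [X] only in their values on measurable sets, so
    the quantities built from a law have to be transported. Equality of the whole functionals
    permits rewriting inside the mean and the covariance. *)
Lemma eq_expectation mu nu :
  (forall A, measurable A -> mu A = nu A) ->
  expectation mu = expectation nu.
Proof.
move=> munu; apply/funext => f; rewrite unlock.
by apply: eq_measure_integral => A mA _; exact: munu.
Qed.

Lemma eq_mean_vec mu nu : (forall A, measurable A -> mu A = nu A) ->
  mean_vec mu = mean_vec nu.
Proof. by move=> /eq_expectation munu; rewrite /mean_vec munu. Qed.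

Lemma eq_cov_mx mu nu : (forall A, measurable A -> mu A = nu A) ->
  cov_mx mu = cov_mx nu.
Proof.
move=> /eq_expectation munu; apply/matrixP => i j.
by rewrite !mxE; congr fine; rewrite unlock munu.
Qed.

Lemma eq_finite_second_moment mu nu :
  (forall A, measurable A -> mu A = nu A) ->
  finite_second_moment mu -> finite_second_moment nu.
Proof.
move=> munu; rewrite /finite_second_moment.
by rewrite (eq_measure_integral nu)// => A mA _; exact: munu.
Qed.

End tuple_law.

(** * Moments of the concatenation of two random vectors *)

Section joint_law.
Context {d : measure_display} {T : measurableType d} {R : realType}
  {P : probability T R} {n p : nat}
  (X : {RV P >-> n.-tuple R}) (Y : {RV P >-> p.-tuple R}).
Hypotheses (X2 : finite_second_moment (law X))
  (Y2 : finite_second_moment (law Y)).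

Local Notation coord i := (fun x => tnth x i).

(** Moving the moment condition to the common space [P] pays off because there each coordinate of
    the joint vector is a coordinate of [X] or of [Y]. *)
Lemma coord_RV_Lfun2 (q : nat) (Z : {RV P >-> q.-tuple R}) :
  finite_second_moment (law Z) <->
  forall i, (coord i) \o Z \in Lfun P 2%:E.
Proof.
have coordZ i : coord i \in Lfun (law Z) 2%:E <->
    (coord i) \o Z \in Lfun P 2%:E.
  by apply: Lfun2_distribution; exact: measurable_tnth.
by rewrite finite_second_momentP; split=> Z2 i; apply/coordZ.
Qed.

Lemma coord_joint_lshift i :
  (coord (lshift p i)) \o joint X Y = (coord i) \o X.
Proof. by apply/funext => w /=; rewrite tnth_lshift. Qed.

Lemma coord_joint_rshift i :
  (coord (rshift n i)) \o joint X Y = (coord i) \o Y.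
Proof. by apply/funext => w /=; rewrite tnth_rshift. Qed.

Lemma finite_second_moment_joint : finite_second_moment (law (joint X Y)).
Proof.
apply/coord_RV_Lfun2 => i; case: (split_ordP i) => j ->.
- by rewrite coord_joint_lshift; move/coord_RV_Lfun2 : X2; exact.
- by rewrite coord_joint_rshift; move/coord_RV_Lfun2 : Y2; exact.
Qed.

Lemma mean_vec_law (q : nat) (Z : {RV P >-> q.-tuple R}) :
  finite_second_moment (law Z) ->
  forall i, mean_vec (law Z) i 0 = fine ('E_P[(coord i) \o Z])%E.
Proof.
move=> /coord_RV_Lfun2 Z2 i.
rewrite mxE expectation_distribution//; first exact: measurable_tnth.
exact: Lfun2_Lfun1.
Qed.

Lemma cov_mx_law (q : nat) (Z : {RV P >-> q.-tuple R}) :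
  finite_second_moment (law Z) ->
  forall i j, cov_mx (law Z) i j =
    fine (covariance P ((coord i) \o Z) ((coord j) \o Z)).
Proof.
move=> /coord_RV_Lfun2 Z2 i j.
by rewrite mxE covariance_distribution//; exact: measurable_tnth.
Qed.

Lemma mean_vec_joint :
  mean_vec (law (joint X Y)) = col_mx (mean_vec (law X)) (mean_vec (law Y)).
Proof.
apply/colP => i; rewrite mean_vec_law; last exact: finite_second_moment_joint.
case: (split_ordP i) => j ->.
- by rewrite coord_joint_lshift col_mxEu mean_vec_law.
- by rewrite coord_joint_rshift col_mxEd mean_vec_law.
Qed.

Hypothesis XY : independent_RV X Y.

(** Independence enters through the off-diagonal blocks, whose entries are covariances between a
    coordinate of [X] and one of [Y]. *)
Lemma cov_mx_joint :
  cov_mx (law (joint X Y)) = block_mx (cov_mx (law X)) 0 0 (cov_mx (law Y)).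
Proof.
have cXY i j : covariance P ((coord i) \o X) ((coord j) \o Y) = 0%E.
  apply: independent_covariance0 => //; [exact: measurable_tnth..| |].
  - by move/coord_RV_Lfun2 : X2; exact.
  - by move/coord_RV_Lfun2 : Y2; exact.
apply/matrixP => i j; rewrite cov_mx_law; last exact: finite_second_moment_joint.
case: (split_ordP i) => i' ->; case: (split_ordP j) => j' ->.
- by rewrite !coord_joint_lshift block_mxEul cov_mx_law.
- by rewrite coord_joint_lshift coord_joint_rshift block_mxEur mxE cXY.
- rewrite coord_joint_lshift coord_joint_rshift block_mxEdl mxE covarianceC.
  by rewrite cXY.
- by rewrite !coord_joint_rshift block_mxEdr cov_mx_law.
Qed.

Hypotheses (XU : cov_mx (law X) \in unitmx) (YU : cov_mx (law Y) \in unitmx).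

Lemma cov_mx_joint_unit : cov_mx (law (joint X Y)) \in unitmx.
Proof.
by rewrite cov_mx_joint unitmxE det_ublock unitrM -!unitmxE XU YU.
Qed.

(** The inverse of an invertible block diagonal matrix is block diagonal, so no cross term between
    [u] and [v] survives. *)
Lemma inv_cov_form_joint (u : 'cV[R]_n) (v : 'cV[R]_p) :
  inv_cov_form (law (joint X Y)) (col_mx u v) =
  inv_cov_form (law X) u + inv_cov_form (law Y) v.
Proof.
have := cov_mx_joint_unit; rewrite /inv_cov_form cov_mx_joint => U.
rewrite invmx_block_diag// tr_col_mx mul_row_block !mulmx0 addr0 add0r.
by rewrite mul_row_col mxE.
Qed.

End joint_law.

Theorem mainTheorem4 (R : realType) (n : nat) (n_ge1 : (1 <= n)%N)
  (d : measure_display) (T : measurableType d) (P : probability T R)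
  (X : {RV P >-> n.-tuple R})
  (X_second_moment : finite_second_moment (law X))
  (X_mean_neq0 : mean_vec (law X) != 0)
  (X_cov_unit : cov_mx (law X) \in unitmx)
  (d' : measure_display) (T' : measurableType d') (P' : probability T' R)
  (X1 X2 : {RV P' >-> n.-tuple R})
  (X1_law : forall A : set (n.-tuple R), measurable A -> law X1 A = law X A)
  (X2_law : forall A : set (n.-tuple R), measurable A -> law X2 A = law X A)
  (X12_indep : independent_RV X1 X2) :
  [/\ finite_second_moment (law (joint X1 X2)),
      mean_vec (law (joint X1 X2)) != 0,
      cov_mx (law (joint X1 X2)) \in unitmx
    & G2 (joint X1 X2) = G2 X].
Proof.
have X1_2 : finite_second_moment (law X1).
  by apply: eq_finite_second_moment X_second_moment => A mA; rewrite X1_law.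
have X2_2 : finite_second_moment (law X2).
  by apply: eq_finite_second_moment X_second_moment => A mA; rewrite X2_law.
have [m1 m2] := (eq_mean_vec X1_law, eq_mean_vec X2_law).
have [c1 c2] := (eq_cov_mx X1_law, eq_cov_mx X2_law).
have joint_2 := finite_second_moment_joint X1_2 X2_2.
have joint_unit : cov_mx (law (joint X1 X2)) \in unitmx.
  by apply: cov_mx_joint_unit; rewrite ?c1 ?c2.
have joint_mean := mean_vec_joint X1_2 X2_2.
(* A stacked vector is nonzero as soon as one block is. *)
split=> //; first by rewrite joint_mean m1 m2 col_mx_eq0 negb_and X_mean_neq0.
rewrite /G2 !G2_lawE// joint_mean inv_cov_form_joint ?c1 ?c2//.
(* The form depends on the law only through the covariance matrix; once unfolded, both summands
   become the form of [X]. *)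
rewrite m1 m2 /inv_cov_form c1 c2 natrD -!mulr2n.
(* Numerator and denominator are both doubled; the factor 2 / 2 is split off and equals 1. *)
by rewrite -[_ *+ 2 in X in X / _]mulr_natr -[X in _ / X]mulr_natr -mulf_div
  divff ?pnatr_eq0// mulr1.
Qed.
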